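(* Let $\mathcal{S} = \{(p',q') \in [0,1]^{2} : 0 < p'+q' \leqslant 1\}$. For every $(p,q)\in\mathcal{S}$ and for each of the percolation games V1, V2 and V3 on $\mathbb{Z}^2$ with parameters $p$ and $q$, the game has probability $0$ of culminating in a draw if and only if the PCA $F_{p,q}$ is ergodic.
   Context: Percolation game with parameters $p,q$ and move sets $\mathrm{Out}(x,y)$: each vertex of $\mathbb{Z}^{2}$ is independently assigned a random label, namely ''trap'' with probability $p$, ''target'' with probability $q$, and ''open'' with probability $r = 1-p-q$. After the labels are revealed to both players, a token is placed at an initial vertex, and two players take turns moving it; a move relocates the token from its current position $(x,y)$ to any vertex of $\mathrm{Out}(x,y)$. A player who moves the token to a trap loses immediately, and a player who moves the token to a target wins immediately. If the token never lands on a trap or a target, the game continues forever. The versions are: (V1) $\mathrm{Out}(x,y) = \{(x,y+2), (x+1,y+1), (x+2,y)\}$; (V2) $\mathrm{Out}(x,y) = \{(x,y+1), (x+1,y+1), (x+2,y+1)\}$; (V3) $\mathrm{Out}(x,y) = \{(x+1,y), (x,y+1), (x-1,y+2)\}$. For a given labeling, a player wins the game from a given initial vertex if she has a strategy that makes her win (in finitely many moves) against every strategy of the opponent. An initial vertex is in class $W$ if the player who moves first wins, in class $L$ if the player who moves first loses (i.e. the other player wins), and in class $D$ (draw) if neither player has a winning strategy. By convention, if the initial vertex itself is a trap it is placed in $W$, and if it is a target it is placed in $L$. The probability of draw is the probability (over the random labeling) that the initial vertex is in class $D$; by translation invariance it does not depend on the initial vertex, which may be taken to be the origin. A (one-dimensional)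 probabilistic cellular automaton (PCA) $F$ with finite alphabet $\mathcal{A}$, neighbourhood $\mathcal{N}=\{y_1,\dots,y_m\}\subset\mathbb{Z}$ and stochastic matrix $\varphi:\mathcal{A}^{m}\times\mathcal{A}\to[0,1]$ acts on configurations $\eta\in\mathcal{A}^{\mathbb{Z}}$ as follows: given $\eta$, the random configuration $F\eta\in\mathcal{A}^{\mathbb{Z}}$ has independent coordinates, with $\mathbf{P}[F\eta(x)=b]=\varphi(\eta(x+y_1),\dots,\eta(x+y_m),b)$ for $x\in\mathbb{Z}$, $b\in\mathcal{A}$. If $\eta$ is random with law $\mu$ (a probability measure on $\mathcal{A}^{\mathbb{Z}}$ with the $\sigma$-field generated by cylinder sets), $F\mu$ denotes the law of $F\eta$, and $F^{t}\mu=F(F^{t-1}\mu)$. A measure $\mu$ is stationary for $F$ if $F\mu=\mu$. The PCA $F$ is ergodic if it has a unique stationary measure $\mu$ and, for every probability measure $\nu$ on $\mathcal{A}^{\mathbb{Z}}$, $F^{t}\nu$ converges weakly to $\mu$ as $t\to\infty$. The PCA $F_{p,q}$ has alphabet $\mathcal{A}=\{0,1\}$, neighbourhood $\mathcal{N}=\{0,1,2\}$ and stochastic matrix $\varphi_{p,q}$ given by $\varphi_{p,q}(0,0,0,0)=p$, $\varphi_{p,q}(0,0,0,1)=1-p$, and $\varphi_{p,q}(a_0,a_1,a_2,0)=1-q$, $\varphi_{p,q}(a_0,a_1,a_2,1)=q$ for all $(a_0,a_1,a_2)\in\{0,1\}^3\setminus\{(0,0,0)\}$. *)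

(* Defs.v *)
From mathcomp Require Import all_boot all_order all_algebra.
From mathcomp Require Import all_classical all_reals all_analysis.
Set Implicit Arguments.
Unset Strict Implicit.
Unset Printing Implicit Defensive.
Import Order.TTheory GRing.Theory Num.Theory.
Import numFieldNormedType.Exports.
Local Open Scope classical_set_scope.
Local Open Scope ring_scope.

Definition vertex : Type := (int * int)%type.

Inductive label := Trap | Target | Open.

Inductive version := V1 | V2 | V3.

Definition Out (g : version) (v : vertex) : seq vertex :=
  let: (x, y) := v in
  match g with
  | V1 => [:: (x, y + 2); (x + 1, y + 1); (x + 2, y)]
  | V2 => [:: (x, y + 1); (x + 1, y + 1); (x + 2, y + 1)]
  | V3 => [:: (x + 1, y); (x, y + 1); (x - 1, y + 2)]
  end.

Inductive player := First | Second.

Definition opponent (a : player) : player :=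
  match a with First => Second | Second => First end.

(** A strategy maps the history of the game (the vertices visited so far, the
    current one at the head) to the next vertex. *)
Definition strategy := seq vertex -> vertex.

Definition legal (g : version) (s : strategy) : Prop :=
  forall (v : vertex) (h : seq vertex), s (v :: h) \in Out g v.

(** [mover n] makes the move from [position s v n] to [position s v n.+1]. *)
Definition mover (n : nat) : player := if odd n then Second else First.

Fixpoint history (s : player -> strategy) (v : vertex) (n : nat) : seq vertex :=
  if n is m.+1 then s (mover m) (history s v m) :: history s v m else [:: v].

Definition position (s : player -> strategy) (v : vertex) (n : nat) : vertex :=
  head v (history s v n).

(** The token stays on open vertices until move [n], which ends the game in
    favour of [a]: either [a] reaches a target or the opponent a trap. *)
Definition play_won_by (lab : vertex -> label) (s : player -> strategy)
    (v : vertex) (a : player) : Prop :=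
  exists n : nat,
    (forall k : nat, (0 < k <= n)%N -> lab (position s v k) = Open) /\
    ((mover n = a /\ lab (position s v n.+1) = Target) \/
     (mover n = opponent a /\ lab (position s v n.+1) = Trap)).

Definition profile (s1 s2 : strategy) (a : player) : strategy :=
  match a with First => s1 | Second => s2 end.

Definition first_wins (g : version) (lab : vertex -> label) (v : vertex) : Prop :=
  exists2 s1 : strategy, legal g s1 &
    forall s2 : strategy, legal g s2 -> play_won_by lab (profile s1 s2) v First.

Definition second_wins (g : version) (lab : vertex -> label) (v : vertex) : Prop :=
  exists2 s2 : strategy, legal g s2 &
    forall s1 : strategy, legal g s1 -> play_won_by lab (profile s1 s2) v Second.

Definition classW (g : version) (lab : vertex -> label) (v : vertex) : Prop :=
  lab v = Trap \/ (lab v = Open /\ first_wins g lab v).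

Definition classL (g : version) (lab : vertex -> label) (v : vertex) : Prop :=
  lab v = Target \/ (lab v = Open /\ second_wins g lab v).

Definition classD (g : version) (lab : vertex -> label) (v : vertex) : Prop :=
  ~ classW g lab v /\ ~ classL g lab v.

Definition label_prob (R : realType) (p q : R) (l : label) : R :=
  match l with Trap => p | Target => q | Open => 1 - p - q end.

Record iid_labelling (R : realType) (p q : R) (d : measure_display)
    (Omega : measurableType d) (P : probability Omega R)
    (lab : Omega -> vertex -> label) : Prop := IIDLabelling {
  labelling_measurable : forall (v : vertex) (l : label),
    measurable [set w | lab w v = l] ;
  labelling_law : forall (v : vertex) (l : label),
    P [set w | lab w v = l] = (label_prob p q l)%:E ;
  labelling_independent : forall (s : seq vertex) (B : vertex -> set label),
    uniq s ->
    P (\bigcap_(v in [set` s]) [set w | B v (lab w v)]) =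
    (\prod_(v <- s) P [set w | B v (lab w v)])%E }.

Definition draw_probability (R : realType) (d : measure_display)
    (Omega : measurableType d) (P : probability Omega R)
    (lab : Omega -> vertex -> label) (g : version) : \bar R :=
  P [set w | classD g (lab w) (0, 0)].

(** The symbols 0 and 1 are [false] and [true]. *)
Definition cylinders : set (set (int -> bool)) :=
  [set A | exists (x : int) (b : bool), A = [set eta | eta x = b]].

Notation config := (g_sigma_algebraType cylinders).

Record pca (R : realType) := PCA {
  arity : nat ;
  neighbourhood : arity.-tuple int ;
  local_rule : arity.-tuple bool -> bool -> R }.

Definition stochastic (R : realType) (F : pca R) : Prop :=
  forall a : (arity F).-tuple bool,
    (forall b : bool, 0 <= local_rule a b :> R) /\
    \sum_(b : bool) local_rule a b = 1 :> R.

Definition window (R : realType) (F : pca R) (eta : config) (x : int) :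
  (arity F).-tuple bool := [tuple of [seq eta (x + y) | y <- neighbourhood F]].

(** [is_image F mu nu] : [nu] is the law [F mu].  Conditionally on [eta], the
    coordinates of [F eta] are independent with the given marginals, so that
    the conditional probability of a finite-dimensional event is a product; it
    is then averaged over [eta] of law [mu].  These values on the
    finite-dimensional events determine [nu]. *)
Definition is_image (R : realType) (F : pca R)
    (mu nu : probability config R) : Prop :=
  forall (s : seq int) (b : int -> bool), uniq s ->
    nu [set xi : config | forall x : int, x \in s -> xi x = b x] =
    (\int[mu]_eta (\prod_(x <- s) local_rule (window F eta x) (b x))%:E)%E.

Definition stationary (R : realType) (F : pca R) (mu : probability config R) :
  Prop := is_image F mu mu.

(** [nu_ t] is the law [F^t (nu_ 0)] for every [t]. *)
Definition is_orbit (R : realType) (F : pca R)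
    (nu_ : nat -> probability config R) : Prop :=
  forall t : nat, is_image F (nu_ t) (nu_ t.+1).

Definition weakly_converges (R : realType) (nu_ : nat -> probability config R)
    (mu : probability config R) : Prop :=
  forall f : {ptws int -> bool} -> R,
    continuous f -> (exists M : R, forall eta, `|f eta| <= M) ->
    (\int[nu_ t]_eta (f eta)%:E)%E @[t --> \oo] -->
    (\int[mu]_eta (f eta)%:E)%E.

(** Measures are compared on measurable sets only, since their values elsewhere
    are not constrained. *)
Definition ergodic (R : realType) (F : pca R) : Prop :=
  exists mu : probability config R,
    [/\ stationary F mu,
        forall mu' : probability config R, stationary F mu' ->
          forall A : set config, measurable A -> mu' A = mu A
      & forall nu_ : nat -> probability config R, is_orbit F nu_ ->
          weakly_converges nu_ mu].

Definition percolation_rule (R : realType) (p q : R) (a : 3.-tuple bool)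
    (b : bool) : R :=
  if a == [tuple false; false; false] then (if b then 1 - p else p)
  else (if b then q else 1 - q).

Definition percolation_pca (R : realType) (p q : R) : pca R :=
  PCA [tuple 0; 1; 2] (percolation_rule p q).

Lemma percolation_pca_stochastic (R : realType) (p q : R) :
  0 <= p <= 1 -> 0 <= q <= 1 -> stochastic (percolation_pca p q).
Proof.
move=> /andP[p0 p1] /andP[q0 q1] a; split=> /= [b|].
  by rewrite /percolation_rule; case: ifP => _; case: b; rewrite ?subr_ge0.
rewrite big_bool /= /percolation_rule; case: ifP => _.
  by rewrite subrK.
by rewrite addrC subrK.
Qed.

(* Main.v *)
(** In suitable coordinates [(t, n)] each of the three games moves from
    [(t, n)] to one of [(t+1, n)], [(t+1, n+1)], [(t+1, n+2)].  Reading classes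
    W and L as the symbols 0 and 1, the class of a vertex is computed from those
    of its three successors and from its label exactly as one step of the PCA;
    hence imposing a configuration [eta] at depth [k] and working backwards
    produces at depth 0 a random configuration of law F^k(delta_eta).

    The backward step is decreasing, so among all [eta] the constants 0 and 1 are
    extremal: the outcome at a vertex is decided within [k] moves if and only if
    these two boundary conditions agree there.  The probability of being
    undecided within [k] moves is therefore
    [u_k = |F^k(delta_1)[eta 0 = 1] - F^k(delta_0)[eta 0 = 1]|], and
    P(draw) = lim u_k.  If F is ergodic, both terms have the same limit.
    Conversely, if [u_k] tends to 0, the law of the limiting W/L configuration
    is within [size s * u_k] of F^k(nu) on any event fixing the symbols at the
    sites [s], for every initial law [nu]; this yields stationarity, uniqueness
    and weak convergence. *)
Require Import Defs.
From mathcomp Require Import all_boot all_order all_algebra.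
From mathcomp Require Import all_classical all_reals all_analysis.
From mathcomp Require Import ring lra zify.
Set Implicit Arguments.
Unset Strict Implicit.
Unset Printing Implicit Defensive.
Import Order.TTheory GRing.Theory Num.Theory.
Import numFieldNormedType.Exports.
Local Open Scope classical_set_scope.
Local Open Scope ring_scope.

(** * Determinacy: draws are the vertices undecided at every depth *)

Section Game.
Variables (g : version) (lab : vertex -> label).

(* Backward induction over [k] moves, a token still in play after [k] moves
   being given the symbol [e]; [true] stands for class L, [false] for W. *)
Fixpoint val_at (e : bool) (k : nat) (v : vertex) : bool :=
  if k is k'.+1 then
    match lab v with
    | Target => true
    | Trap => false
    | Open => all (fun u => ~~ val_at e k' u) (Out g v)
    end
  else e.

(* The boundary symbol that makes an undecided vertex look like W, for [Lwithin],
   or like L, for [Wwithin], alternates with the depth. *)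
Definition Lwithin (k : nat) (v : vertex) : bool := val_at (odd k) k v.
Definition Wwithin (k : nat) (v : vertex) : bool := ~~ val_at (~~ odd k) k v.

Lemma LwithinS k v : Lwithin k.+1 v =
  match lab v with Target => true | Trap => false | Open => all (Wwithin k) (Out g v) end.
Proof. by []. Qed.

Lemma WwithinS k v : Wwithin k.+1 v =
  match lab v with
  | Target => false | Trap => true | Open => has (Lwithin k) (Out g v) end.
Proof.
rewrite /Wwithin /=; case: (lab v) => //; rewrite -has_predC negbK.
by apply: eq_has => u; rewrite /= negbK.
Qed.

(** The boundary symbols are chosen so that both predicates are false at depth 0, which makes the
    base case vacuous; afterwards each predicate is monotone in the other. *)
Lemma within_incr k v : (Lwithin k v -> Lwithin k.+1 v) /\ (Wwithin k v -> Wwithin k.+1 v).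
Proof.
elim: k v => [//|k IH] v; split.
  rewrite !LwithinS; case: (lab v) => //; apply: sub_all => u; exact: (IH u).2.
rewrite !WwithinS; case: (lab v) => //; apply: sub_has => u; exact: (IH u).1.
Qed.

Lemma Lwithin_mono k j v : (k <= j)%N -> Lwithin k v -> Lwithin j v.
Proof.
move=> /subnK <-; elim: (j - k)%N => [//|m IH] /IH; rewrite addSn.
exact: (within_incr _ _).1.
Qed.

Lemma Wwithin_mono k j v : (k <= j)%N -> Wwithin k v -> Wwithin j v.
Proof.
move=> /subnK <-; elim: (j - k)%N => [//|m IH] /IH; rewrite addSn.
exact: (within_incr _ _).2.
Qed.

Lemma LWwithin_disj k v : Lwithin k v -> Wwithin k v -> False.
Proof.
elim: k v => [//|k IH] v; rewrite LwithinS WwithinS; case: (lab v) => //.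
by move=> /allP aW /hasP[u uO Lu]; apply: IH Lu (aW _ uO).
Qed.

Lemma Out_ex v : exists u, u \in Out g v.
Proof.
by case: v => x y; case: g => /=; eexists; exact: mem_head.
Qed.

Lemma Wwithin_uniform (s : seq vertex) :
  (forall u, u \in s -> exists k, Wwithin k u) -> exists K, all (Wwithin K) s.
Proof.
elim: s => [|u s IH] H; first by exists 0%N.
have [|K aK] := IH; first by move=> x xs; apply: H; rewrite inE xs orbT.
have [k Wk] := H u (mem_head _ _).
exists (maxn k K) => /=; rewrite (Wwithin_mono (leq_maxl _ _) Wk) /=.
by apply: sub_all aK => x; apply: Wwithin_mono; rewrite leq_maxr.
Qed.

Definition positional (f : vertex -> vertex) : strategy :=
  fun h => f (head (0, 0) h).

Lemma positional_legal f : (forall u, f u \in Out g u) -> legal g (positional f).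
Proof. by move=> H v h; apply: H. Qed.

Section Play.
Variables (s : player -> strategy) (v : vertex).
Hypothesis slegal : forall a, legal g (s a).

Lemma historyE n : exists h, history s v n = position s v n :: h.
Proof. by case: n => [|n]; [exists [::]|exists (history s v n)]. Qed.

Lemma positionS n : position s v n.+1 = s (mover n) (history s v n).
Proof. by []. Qed.

Lemma position_Out n : position s v n.+1 \in Out g (position s v n).
Proof. by rewrite positionS; have [h ->] := historyE n; apply: slegal. Qed.

Lemma position_positional n f : s (mover n) = positional f ->
  position s v n.+1 = f (position s v n).
Proof. by rewrite positionS => ->; have [h ->] := historyE n. Qed.

Lemma moverS n : mover n.+1 = opponent (mover n).
Proof. by rewrite /mover /=; case: (odd n). Qed.

Lemma opponentK a : opponent (opponent a) = a. Proof. by case: a. Qed.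

(** The strict drop in depth is what forces the win in finitely many moves. *)
Definition attack (f : vertex -> vertex) :=
  forall u k, Wwithin k u -> lab u = Open -> exists2 j, (j < k)%N & Lwithin j (f u).

(** Strong induction on the depth: W at the turns of [a] and L at those of the opponent is preserved
    by every move, while the depth strictly decreases until the game ends. *)
Lemma attack_wins a f : s a = positional f -> attack f ->
  forall k n, (forall i, (0 < i <= n)%N -> lab (position s v i) = Open) ->
  lab (position s v n) = Open ->
  (mover n = a /\ Wwithin k (position s v n)) \/
  (mover n = opponent a /\ Lwithin k (position s v n)) ->
  play_won_by lab s v a.
Proof.
move=> sa fA; elim/ltn_ind => k IH n opn on.
have step j : (j < k)%N -> lab (position s v n.+1) = Open ->
    (mover n.+1 = a /\ Wwithin j (position s v n.+1)) \/
    (mover n.+1 = opponent a /\ Lwithin j (position s v n.+1)) ->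
    play_won_by lab s v a.
  move=> jk o1 H; apply: (IH j jk n.+1) => // i /andP[i0].
  rewrite leq_eqVlt => /orP[/eqP->//|]; rewrite ltnS => iN.
  by apply: opn; rewrite i0.
case=> [[mn Wk]|[mn Lk]].
  have [j jk] := fA _ _ Wk on.
  rewrite -(@position_positional n f) ?mn//.
  case E : (lab (position s v n.+1)).
  - by case: j jk => [//|j] jk; rewrite LwithinS E.
  - by move=> _; exists n; split => //; left.
  - by move=> Lj; apply: (step j) => //; right; split=> //; rewrite moverS mn.
case: k Lk {IH} step => [//|k]; rewrite LwithinS on => /allP /(_ _ (position_Out n)) W step.
case E : (lab (position s v n.+1)).
- by exists n; split => //; right.
- by case: k W {step} => [//|k]; rewrite WwithinS E.
- by apply: (step k) => //; left; split => //; rewrite moverS mn opponentK.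
Qed.

Definition evade (f : vertex -> vertex) :=
  forall u, lab u = Open -> (forall k, ~~ Lwithin k u) -> forall k, ~~ Wwithin k (f u).

(** The invariant is that [a] never moves from a vertex in L and the opponent never from one in W,
    at any depth; a final losing move would contradict it. *)
Lemma evade_not_lost a f : s a = positional f -> evade f ->
  lab v = Open ->
  (mover 0 = a -> forall k, ~~ Lwithin k v) ->
  (mover 0 = opponent a -> forall k, ~~ Wwithin k v) ->
  ~ play_won_by lab s v (opponent a).
Proof.
move=> sa fE ov Lv Wv [n [opn wn]].
have op i : (i <= n)%N -> lab (position s v i) = Open.
  by case: i => [_ //|i iN]; apply: opn.
have key i : (i <= n)%N ->
    (mover i = a -> forall k, ~~ Lwithin k (position s v i)) /\
    (mover i = opponent a -> forall k, ~~ Wwithin k (position s v i)).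
  elim: i => [//|i IH iN]; have [IL IW] := IH (ltnW iN).
  split => m k; rewrite moverS in m.
    have mi : mover i = opponent a by rewrite -m opponentK.
    apply/negP => Lk; have := IW mi k.+1; rewrite WwithinS op ?(ltnW iN)//.
    by move/negP; apply; apply/hasP; exists (position s v i.+1) => //; exact: position_Out.
  have mi : mover i = a by rewrite -(opponentK (mover i)) m opponentK.
  rewrite (@position_positional i f) ?mi//; apply: fE; last exact: IL.
  by apply: op; rewrite ltnW.
have [IL IW] := key n (leqnn n).
case: wn => [[mn tn]|[mn tn]].
  (* Depth 0 decides nothing, so the target is L at depth 1 and the vertex before it is W at depth
     2. *)
  have := IW mn 2; rewrite WwithinS op// => /negP; apply.
  by apply/hasP; exists (position s v n.+1); [exact: position_Out|rewrite LwithinS tn].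
rewrite opponentK in mn; have := fE _ (op n (leqnn _)) (IL mn) 1.
by rewrite -(@position_positional n f) ?mn// WwithinS tn.
Qed.

End Play.

Lemma attack_exists : exists2 f, (forall u, f u \in Out g u) & attack f.
Proof.
have H u : exists w, w \in Out g u /\ (forall k, Wwithin k u -> lab u = Open ->
    exists2 j, (j < k)%N & Lwithin j w).
  have [w0 w0O] := Out_ex u.
  have [exW|nW] := pselect (exists k, Wwithin k u); last first.
    by exists w0; split => // k Wk; exfalso; apply: nW; exists k.
  have [ou|nou] := pselect (lab u = Open); last by exists w0; split.
  (* The successor is chosen at the least depth [m.+1] deciding [u]; then [m < k] for every [k] with
     [Wwithin k u], so one choice serves them all. *)
  case: (ex_minnP exW) => -[//|m] + mmin.
  rewrite WwithinS ou => /hasP[w wO Lw]; exists w; split => // k /mmin mk _.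
  by exists m.
have [f fP] := choice H.
by exists f => u; [exact: (fP u).1|exact: (fP u).2].
Qed.

(** If every successor of [u] were eventually W, finiteness of [Out g u] and monotonicity would give
    a common depth [K], making [u] L within [K.+1]. *)
Lemma evade_exists : exists2 f, (forall u, f u \in Out g u) & evade f.
Proof.
have H u : exists w, w \in Out g u /\ (lab u = Open ->
    (forall k, ~~ Lwithin k u) -> forall k, ~~ Wwithin k w).
  have [w0 w0O] := Out_ex u.
  have [ou|nou] := pselect (lab u = Open); last by exists w0; split.
  have [Lu|nL] := pselect (forall k, ~~ Lwithin k u); last by exists w0; split.
  have [[w [wO wW]]|nw] := pselect (exists w, w \in Out g u /\ forall k, ~~ Wwithin k w).
    by exists w; split.
  have [|K aK] := @Wwithin_uniform (Out g u).
    move=> w wO; apply: contrapT => nk; apply: nw; exists w; split => // k.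
    by apply/negP => Wk; apply: nk; exists k.
  by have := Lu K.+1; rewrite LwithinS ou aK.
have [f fP] := choice H.
by exists f => u; [exact: (fP u).1|exact: (fP u).2].
Qed.

(** Positional strategies suffice: from a vertex decided at some depth one player attacks and wins,
    and from a vertex never decided either player can evade every strategy of the other. *)
Lemma classDE v : classD g lab v <-> forall k, ~~ Lwithin k v && ~~ Wwithin k v.
Proof.
have [fa fal faA] := attack_exists; have [fe fel feE] := evade_exists.
have prof_legal s1 s2 a : legal g s1 -> legal g s2 -> legal g (profile s1 s2 a).
  by case: a.
split=> [[nW nL] k|H].
  rewrite -negb_or; apply/negP => LWk.
  case E : (lab v); [by apply: nW; left|by apply: nL; left|].
  case/orP: LWk => [Lk|Wk].
    apply: nL; right; split => //; exists (positional fa); first exact: positional_legal.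
    move=> s1 s1l; apply: (@attack_wins _ v _ Second fa _ _ k 0%N) => //; last by right.
      by move=> a; apply: prof_legal => //; exact: positional_legal.
    by case.
  apply: nW; right; split => //; exists (positional fa); first exact: positional_legal.
  move=> s2 s2l; apply: (@attack_wins _ v _ First fa _ _ k 0%N) => //; last by left.
    by move=> a; apply: prof_legal => //; exact: positional_legal.
  by case.
have Lv k : ~~ Lwithin k v by have /andP[] := H k.
have Wv k : ~~ Wwithin k v by have /andP[] := H k.
have ov : lab v = Open.
  case E : (lab v) => //.
    by have := Wv 1%N; rewrite WwithinS E.
  by have := Lv 1%N; rewrite LwithinS E.
split=> -[|[_ [s sl sW]]]; rewrite ?ov//.
  apply: (@evade_not_lost _ v _ Second fe _ _ _ _ _ (sW (positional fe) _)) => //.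
    by move=> a; apply: prof_legal => //; exact: positional_legal.
  exact: positional_legal.
apply: (@evade_not_lost _ v _ First fe _ _ _ _ _ (sW (positional fe) _)) => //.
  by move=> a; apply: prof_legal => //; exact: positional_legal.
exact: positional_legal.
Qed.

End Game.

(** * Coordinates common to the three games *)

Definition coord (g : version) (t : nat) (n : int) : vertex :=
  match g with
  | V1 => (n, t.*2%:Z - n)
  | V2 => (n, t%:Z)
  | V3 => (t%:Z - n, n)
  end.

Lemma Out_coord g t n : Out g (coord g t n) =
  [:: coord g t.+1 n; coord g t.+1 (n + 1); coord g t.+1 (n + 2)].
Proof.
by case: g => /=; (congr [:: _; _; _] || idtac); congr (_, _); lia.
Qed.

(** Injectivity lets the labels read along [coord] inherit independence. For V1 the image contains
    only vertices of even coordinate sum, a parity that every move preserves. *)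
Lemma coord_inj g t n t' n' : coord g t n = coord g t' n' -> t = t' /\ n = n'.
Proof. by case: g => -[] *; split; lia. Qed.

Lemma coord0 g : coord g 0 0 = (0, 0).
Proof. by case: g. Qed.

(** * Real-valued probabilities and finite partitions *)

Section Pr.
Context {R : realType} {d : measure_display} {T : measurableType d}.
Variable mu : probability T R.

Definition Pr (A : set T) : R := fine (mu A).

Lemma PrE A : measurable A -> (Pr A)%:E = mu A.
Proof. by move=> mA; rewrite /Pr fineK// fin_num_measure. Qed.

Lemma Pr_ge0 A : 0 <= Pr A.
Proof. exact/fine_ge0/measure_ge0. Qed.

Lemma Pr_setT : Pr setT = 1.
Proof. by rewrite /Pr probability_setT. Qed.

Lemma Pr_le A B : measurable A -> measurable B -> A `<=` B -> Pr A <= Pr B.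
Proof.
move=> mA mB AB; rewrite -lee_fin !PrE//.
by apply: le_measure => //; rewrite inE.
Qed.

Lemma PrU A B : measurable A -> measurable B -> A `&` B = set0 ->
  Pr (A `|` B) = Pr A + Pr B.
Proof.
move=> mA mB AB; apply: EFin_inj; rewrite EFinD !PrE//; last exact: measurableU.
by rewrite measureU.
Qed.

Lemma Pr_partition (C : finType) (h : T -> C) (E : set T) :
  measurable E -> (forall c, measurable [set x | h x = c]) ->
  Pr E = \sum_(c : C) Pr (E `&` [set x | h x = c]).
Proof.
move=> mE mh.
have mEh c : measurable (E `&` [set x | h x = c]) by exact: measurableI.
have mset (s : seq C) : measurable [set x | h x \in s].
  elim: s => [|c s IH].
    by rewrite (_ : [set x | _] = set0)//; apply/seteqP; split.
  rewrite (_ : [set x | _] = [set x | h x = c] `|` [set x | h x \in s]).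
    exact: measurableU.
  apply/seteqP; split=> x /=; rewrite inE.
    by case/orP => [/eqP|]; [left|right].
  by case=> [->|->]; rewrite ?eqxx ?orbT.
have sumE (s : seq C) : uniq s ->
    Pr (E `&` [set x | h x \in s]) = \sum_(c <- s) Pr (E `&` [set x | h x = c]).
  elim: s => [_|c s IH /= /andP[cs us]].
    rewrite big_nil (_ : _ `&` _ = set0) ?/Pr ?measure0//.
    by apply/seteqP; split=> x //= -[].
  rewrite big_cons -IH// -PrU//; last 2 first.
  - exact: measurableI.
  - by apply/seteqP; split=> x //= -[[_ ->] [_]]; rewrite (negbTE cs).
  congr Pr; rewrite -setIUr; congr (_ `&` _); apply/seteqP; split=> x /=; rewrite inE.
    by case/orP => [/eqP|]; [left|right].
  by case=> [->|->]; rewrite ?eqxx ?orbT.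
rewrite -(sumE _ (index_enum_uniq C)); congr Pr.
by apply/seteqP; split=> x /=; [move=> ?; split => //; rewrite mem_index_enum|case].
Qed.

Lemma measurable_fiber_comp (C : finType) (h : T -> C) (B : pred C) :
  (forall c, measurable [set x | h x = c]) -> measurable [set x | B (h x)].
Proof.
move=> mh; rewrite (_ : [set x | _] = \bigcup_(c in [set c | B c]) [set x | h x = c]).
  by apply: fin_bigcup_measurable => // c _.
by apply/seteqP; split=> x /=; [move=> Bx; exists (h x)|move=> [c Bc ->]].
Qed.

Lemma integral_finite (C : finType) (h : T -> C) (f : C -> R) :
  (forall c, measurable [set x | h x = c]) ->
  (\int[mu]_x (f (h x))%:E)%E = (\sum_(c : C) f c * Pr [set x | h x = c])%:E.
Proof.
move=> mh.
under eq_integral => x _.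
  rewrite (_ : (f (h x))%:E =
    (\sum_(c : C) ((f c)%:E * (\1_[set x | h x = c] x)%:E))%E); last first.
    rewrite (bigD1 (h x))//= big1 ?adde0.
      by rewrite indicE mem_set// mule1.
    by move=> c /eqP hc; rewrite indicE memNset ?mule0//= => /esym.
  over.
have iI c : mu.-integrable setT (fun x => (\1_[set x | h x = c] x)%:E).
  by apply: integrable_indic.
rewrite integral_sum//; last by move=> c; exact: integrableZl.
rewrite -sumEFin; apply: eq_bigr => c _.
by rewrite integralZl// integral_indic// setIT EFinM PrE.
Qed.

(** The coupling inequality; [U] will be the event that some relevant vertex is undecided. *)
Lemma Pr_dist_le (A B U : set T) : measurable A -> measurable B -> measurable U ->
  (forall x, ~ U x -> A x = B x) -> `|Pr A - Pr B| <= Pr U.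
Proof.
move=> mA mB mU AB.
have H X Y : measurable X -> measurable Y -> (forall x, ~ U x -> X x = Y x) ->
    Pr X <= Pr Y + Pr U.
  move=> mX mY XY; apply: (@le_trans _ _ (Pr (Y `|` (U `\` Y)))).
    apply: Pr_le => //; first by apply: measurableU => //; exact: measurableD.
    move=> x Xx; have [Ux|nU] := pselect (U x); last by left; rewrite -XY.
    by have [Yx|nY] := pselect (Y x); [left|right].
  rewrite PrU//; [|exact: measurableD|].
    by rewrite lerD2l; apply: (Pr_le (measurableD mU mY) mU) => x [].
  by apply/seteqP; split=> x //= -[? []].
rewrite ler_norml; apply/andP; split.
  by rewrite lerBrDr addrC lerBlDr; apply: H => // x /AB ->.
by rewrite lerBlDl; exact: H.
Qed.

End Pr.

(** * Cylinder events and finite words *)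

Section Cylinder.
Context {R : realType}.

Definition cyl (s : seq int) (b : int -> bool) : set config :=
  [set eta | forall x : int, x \in s -> eta x = b x].

Lemma measurable_coord (x : int) (b : bool) : measurable [set eta : config | eta x = b].
Proof. by apply: sub_sigma_algebra; exists x, b. Qed.

Lemma measurable_forall_in d (T : measurableType d) (I : eqType) (s : seq I)
    (A : I -> T -> Prop) :
  (forall i, i \in s -> measurable [set x | A i x]) ->
  measurable [set x | forall i, i \in s -> A i x].
Proof.
elim: s => [|i s IH] mA.
  by rewrite (_ : [set x | _] = setT)//; apply/seteqP; split.
rewrite (_ : [set x | _] = [set x | A i x] `&` [set x | forall i, i \in s -> A i x]).
  apply: measurableI; first by apply: mA; rewrite mem_head.
  by apply: IH => j js; apply: mA; rewrite inE js orbT.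
apply/seteqP; split=> x /= H.
  by split=> [|j js]; apply: H; rewrite inE ?eqxx ?js ?orbT.
by move=> j; rewrite inE => /orP[/eqP->|]; [exact: H.1|exact: H.2].
Qed.

Lemma measurable_cyl s b : measurable (cyl s b).
Proof. by apply: measurable_forall_in => x _; exact: measurable_coord. Qed.

(** Off [s] the index runs past a word of length [size s] and yields the default [false], so that a
    finite word becomes a full configuration. *)
Definition ext (s : seq int) (c : seq bool) (x : int) : bool := nth false c (index x s).

Definition restr (s : seq int) (eta : int -> bool) : (size s).-tuple bool :=
  map_tuple eta (in_tuple s).

Lemma ext_restr s eta x : x \in s -> ext s (restr s eta) x = eta x.
Proof. by move=> xs; rewrite /ext /= (nth_map 0) ?index_mem// nth_index. Qed.

Lemma restrP s (eta : int -> bool) (c : (size s).-tuple bool) : uniq s ->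
  restr s eta = c <-> forall x, x \in s -> eta x = ext s c x.
Proof.
move=> us; split=> [<- x xs|H]; first by rewrite ext_restr.
apply/val_inj/(@eq_from_nth _ false); first by rewrite /= size_map size_tuple.
move=> i; rewrite /= size_map => iN; rewrite (nth_map 0)// H ?mem_nth//.
by rewrite /ext index_uniq.
Qed.

Lemma restr_fiber s (c : (size s).-tuple bool) : uniq s ->
  [set eta : config | restr s eta = c] = cyl s (ext s c).
Proof. by move=> us; apply/seteqP; split => eta /= /(restrP _ _ us). Qed.

Lemma law_exists d (T : measurableType d) (P : probability T R) (Z : T -> config) :
  (forall x b, measurable [set w | Z w x = b]) ->
  exists nu : probability config R, forall A, measurable A -> nu A = P (Z @^-1` A).
Proof.
move=> mZ.
have mfZ : measurable_fun setT Z.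
  apply: (@measurability _ _ T config setT Z cylinders erefl).
  move=> _ [_ [x [b ->]] <-]; rewrite setTI; exact: mZ.
pose Zm : {mfun T >-> config} := mfun_Sub (mem_set mfZ).
by exists (distribution P Zm).
Qed.

End Cylinder.

(** * The PCA acting on finite-dimensional distributions *)

Definition win (eta : int -> bool) (x : int) : 3.-tuple bool :=
  [tuple eta x; eta (x + 1); eta (x + 2)].

Lemma window_win (R : realType) (p q : R) eta x :
  window (percolation_pca p q) eta x = win eta x.
Proof. by apply: val_inj; rewrite /= addr0. Qed.

(** The sites that one PCA step reads in order to produce the symbols on [s]. Duplicates are removed
    because words and cylinders correspond only over repetition-free lists. *)
Definition nbh (s : seq int) : seq int :=
  undup (flatten [seq [:: x; x + 1; x + 2] | x <- s]).

Lemma nbh_uniq s : uniq (nbh s). Proof. exact: undup_uniq. Qed.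

Lemma eq_win s (eta eta' : int -> bool) x : x \in s ->
  {in nbh s, eta =1 eta'} -> win eta x = win eta' x.
Proof.
move=> xs E; have H y : y \in [:: x; x + 1; x + 2] -> eta y = eta' y.
  move=> yx; apply: E; rewrite mem_undup; apply/flattenP.
  by exists [:: x; x + 1; x + 2] => //; apply/mapP; exists x.
by rewrite /win !H// !inE eqxx ?orbT.
Qed.

Section Transfer.
Context {R : realType}.
Variables p q : R.

(* The action of the PCA on finite-dimensional distributions. *)
Definition Phi (f : seq int -> (int -> bool) -> R) (s : seq int) (b : int -> bool) : R :=
  \sum_(c : (size (nbh s)).-tuple bool) f (nbh s) (ext (nbh s) c) *
    \prod_(x <- s) percolation_rule p q (win (ext (nbh s) c) x) (b x).

Lemma PhiE f s b : Phi f s b =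
  \sum_(c : (size (nbh s)).-tuple bool) f (nbh s) (ext (nbh s) c) *
    \prod_(x <- s) percolation_rule p q (win (ext (nbh s) c) x) (b x).
Proof. by []. Qed.

Definition fdd (mu : probability config R) (s : seq int) (b : int -> bool) : R :=
  Pr mu (cyl s b).

(** The integrand depends on [eta] only through its word on [nbh s], which turns the integral into
    the finite sum [Phi]. *)
Lemma is_imageP (mu nu : probability config R) :
  is_image (percolation_pca p q) mu nu <->
  forall s b, uniq s -> fdd nu s b = Phi (fdd mu) s b.
Proof.
have key s b : uniq s -> (\int[mu]_eta
    (\prod_(x <- s) percolation_rule p q
      (window (percolation_pca p q) eta x) (b x))%:E)%E = (Phi (fdd mu) s b)%:E.
  move=> us.
  pose f (c : (size (nbh s)).-tuple bool) := \prod_(x <- s)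
    percolation_rule p q (win (ext (nbh s) c) x) (b x).
  transitivity (\int[mu]_eta (f (restr (nbh s) eta))%:E)%E.
    apply: eq_integral => eta _; congr EFin; apply: eq_big_seq => x xs.
    rewrite window_win; congr percolation_rule.
    by apply: (eq_win xs) => y ys; rewrite ext_restr.
  rewrite (@integral_finite _ _ _ mu _ (restr (nbh s)) f).
    congr EFin; apply: eq_bigr => c _; rewrite mulrC; congr (_ * _).
    by rewrite restr_fiber ?nbh_uniq.
  by move=> c; rewrite restr_fiber ?nbh_uniq//; exact: measurable_cyl.
split=> H s b us.
  by apply: EFin_inj; rewrite -key// -[RHS]H// /fdd PrE//; exact: measurable_cyl.
by rewrite [RHS]key// -H// /fdd PrE//; exact: measurable_cyl.
Qed.

(** The finite-dimensional distributions of the point mass at [eta]. *)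
Definition delta (eta : int -> bool) (s : seq int) (b : int -> bool) : R :=
  (all (fun x => eta x == b x) s)%:R.

(** Linearity of [Phi]: iterating from any initial law amounts to averaging the iterates from point
    masses, and only the word on the [k]-fold neighbourhood of [s] matters. *)
Lemma iter_Phi_sum k f s b : uniq s ->
  (forall s b b', {in s, b =1 b'} -> f s b = f s b') ->
  iter k Phi f s b = \sum_(c : (size (iter k nbh s)).-tuple bool)
    iter k Phi (delta (ext (iter k nbh s) c)) s b *
    f (iter k nbh s) (ext (iter k nbh s) c).
Proof.
move=> + fE; elim: k s b => [|k IH] s b us.
  rewrite /= (bigD1 (restr s b))//= big1 ?addr0.
    rewrite /delta (_ : all _ _ = true) ?mul1r.
      by apply: fE => x xs; rewrite ext_restr.
    by apply/allP => x xs; rewrite ext_restr.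
  move=> c /eqP cb; rewrite /delta; case: allP; rewrite ?mul0r// => H.
  by exfalso; apply/cb/esym/restrP => // x /H /eqP.
rewrite [iter k.+1 nbh s]iterSr [in LHS]iterS [LHS]PhiE.
under eq_bigr => c _ do rewrite (IH _ _ (nbh_uniq s)) mulr_suml.
rewrite exchange_big; apply: eq_bigr => c _; rewrite iterS PhiE mulr_suml.
by apply: eq_bigr => c' _; ring.
Qed.

Lemma fdd_local (mu : probability config R) s b b' : {in s, b =1 b'} ->
  fdd mu s b = fdd mu s b'.
Proof.
move=> E; congr (Pr _ _); apply/seteqP; split => eta /= H x xs.
  by rewrite -E ?H.
by rewrite E ?H.
Qed.

Lemma orbit_fdd (nu_ : nat -> probability config R) k s b : uniq s ->
  is_orbit (percolation_pca p q) nu_ -> fdd (nu_ k) s b = iter k Phi (fdd (nu_ 0%N)) s b.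
Proof.
move=> + orb; elim: k s b => [//|k IH] s b us.
rewrite ((is_imageP _ _).1 (orb k))// iterS !PhiE; apply: eq_bigr => c _.
by rewrite IH ?nbh_uniq.
Qed.

Lemma sum_fdd (mu : probability config R) s : uniq s ->
  \sum_(c : (size s).-tuple bool) fdd mu s (ext s c) = 1.
Proof.
move=> us; rewrite -(Pr_setT mu) (@Pr_partition _ _ _ mu _ (restr s))//.
  by apply: eq_bigr => c _; rewrite setTI restr_fiber.
by move=> c; rewrite restr_fiber//; exact: measurable_cyl.
Qed.

(** * Backward iteration driven by independent labels *)

Definition step (l : label) (a : 3.-tuple bool) : bool :=
  match l with
  | Target => true
  | Trap => false
  | Open => a == [tuple false; false; false]
  end.

Definition lprob (B : label -> bool) : R :=
  (if B Trap then p else 0) + (if B Target then q else 0) +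
  (if B Open then 1 - p - q else 0).

(** The link between game and PCA: a random label fed to the deterministic game recursion reproduces
    the local rule. *)
Lemma lprob_step a b : lprob (fun l => step l a == b) = percolation_rule p q a b.
Proof.
rewrite /lprob /percolation_rule /=; case: (a == _); case: b => /=; ring.
Qed.

(* The configuration at level [t] obtained backwards from [eta] at level [t + k]. *)
Fixpoint back (y : nat -> int -> label) (eta : int -> bool) (k t : nat) : int -> bool :=
  if k is k'.+1 then fun n => step (y t n) (win (back y eta k' t.+1) n) else eta.

Section Array.
Context {d : measure_display} {T : measurableType d}.
Variables (P : probability T R) (Y : T -> nat -> int -> label).

Record iid_array : Prop := IIDArray {
  array_measurable : forall t n l, measurable [set w | Y w t n = l] ;
  array_law : forall (l : seq (nat * int)) (B : nat * int -> label -> bool), uniq l ->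
    Pr P [set w | forall i, i \in l -> B i (Y w i.1 i.2)] =
    \prod_(i <- l) lprob (B i) }.

Hypothesis iidY : iid_array.

Lemma measurable_label t n (A : label -> set T) : (forall l, measurable (A l)) ->
  measurable [set w | A (Y w t n) w].
Proof.
move=> mA; have mY := array_measurable iidY t n.
rewrite (_ : [set w | _] = ([set w | Y w t n = Trap] `&` A Trap) `|`
  ([set w | Y w t n = Target] `&` A Target) `|` ([set w | Y w t n = Open] `&` A Open)).
  by apply: measurableU; [apply: measurableU|]; apply: measurableI.
apply/seteqP; split=> w /=; last by case=> [[]|] [->].
by case: (Y w t n) => ?; [left; left|left; right|right].
Qed.

Lemma measurable_bool_set (b : bool) : measurable [set _ : T | b].
Proof.
case: b; first by rewrite (_ : [set _ | _] = setT)//; apply/seteqP; split.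
by rewrite (_ : [set _ | _] = set0)//; apply/seteqP; split.
Qed.

Lemma measurable_win (Z : T -> int -> bool) n c :
  (forall x b, measurable [set w | Z w x = b]) -> measurable [set w | win (Z w) n = c].
Proof.
move=> mZ; rewrite (_ : [set w | _] = [set w | Z w n = tnth c ord0] `&`
  [set w | Z w (n + 1) = tnth c (inord 1)] `&` [set w | Z w (n + 2) = tnth c (inord 2)]).
  by do 2!apply: measurableI => //.
apply/seteqP; split=> w /=.
  by move=> <-; rewrite /win !(tnth_nth false) /= !inordK.
case=> [[H0 H1] H2]; apply/val_inj/(@eq_from_nth _ false); first by rewrite [RHS]size_tuple.
move=> i; rewrite /= => i3; rewrite !(tnth_nth false) /= !inordK// in H0 H1 H2.
by case: i i3 => [|[|[|]]].
Qed.

Lemma measurable_back eta k t n b : measurable [set w | back (Y w) eta k t n = b].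
Proof.
elim: k t n b => [|k IH] t n b /=.
  rewrite (_ : [set _ | _] = [set _ | eta n == b]); first exact: measurable_bool_set.
  by apply/seteqP; split=> w /= /eqP.
apply: (@measurable_label t n
  (fun l => [set w | step l (win (back (Y w) eta k t.+1) n) = b])) => l.
have -> : [set w | step l (win (back (Y w) eta k t.+1) n) = b] =
    [set w | (fun a => step l a == b) (win (back (Y w) eta k t.+1) n)].
  by apply/seteqP; split=> w /= /eqP.
apply: (@measurable_fiber_comp _ _ _ (fun w => win (back (Y w) eta k t.+1) n)
  (fun a => step l a == b)) => c.
exact: measurable_win.
Qed.

Lemma measurable_event (l : seq (nat * int)) (B : nat * int -> label -> bool) :
  measurable [set w | forall i, i \in l -> B i (Y w i.1 i.2)].
Proof.
apply: (@measurable_forall_in _ _ _ l (fun i w => B i (Y w i.1 i.2) : Prop)) => i _.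
by apply: (@measurable_label _ _ (fun l => [set w | B i l])) => ?; exact: measurable_bool_set.
Qed.

Lemma measurable_back_cyl eta k t (s : seq int) b :
  measurable [set w | forall x, x \in s -> back (Y w) eta k t x = b x].
Proof. by apply: measurable_forall_in => x _; exact: measurable_back. Qed.

(* The extra event [l, B] on the levels before [t] is what makes the induction
   go through: conditioning on the configuration at level [t.+1] turns the
   symbols at level [t] into constraints on the labels of that level. *)
Lemma back_law_gen eta k (l : seq (nat * int)) (B : nat * int -> label -> bool) t (s : seq int) b :
  uniq l -> (forall i, i \in l -> (i.1 < t)%N) -> uniq s ->
  Pr P ([set w | forall i, i \in l -> B i (Y w i.1 i.2)] `&`
        [set w | forall x, x \in s -> back (Y w) eta k t x = b x]) =
  (\prod_(i <- l) lprob (B i)) * iter k Phi (delta eta) s b.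
Proof.
elim: k l B t s b => [|k IH] l B t s b ul lt us.
  rewrite /= /delta; case: allP => [E|nE].
    rewrite mulr1 -(array_law iidY)//; congr Pr; apply/seteqP; split=> w /=; first by case.
    by move=> H; split => // x /E /eqP.
  rewrite mulr0 (_ : _ `&` _ = set0) ?/Pr ?measure0//.
  by apply/seteqP; split=> w //= [_ H]; apply: nE => x /H ->.
pose h w := restr (nbh s) (back (Y w) eta k t.+1).
rewrite (@Pr_partition _ _ _ P _ h); last 2 first.
- apply: measurableI; first exact: measurable_event.
  exact: (@measurable_back_cyl eta k.+1).
- move=> c; rewrite (_ : [set _ | _] =
    [set w | forall x, x \in nbh s -> back (Y w) eta k t.+1 x = ext (nbh s) c x]).
    exact: measurable_back_cyl.
  by apply/seteqP; split => w /= /(restrP _ _ (nbh_uniq s)).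
rewrite iterS PhiE mulr_sumr; apply: eq_bigr => c _.
pose B' (i : nat * int) := if i.1 == t
  then fun lb => step lb (win (ext (nbh s) c) i.2) == b i.2 else B i.
pose l' := l ++ [seq (t, x) | x <- s].
have BE i : i \in l -> B' i = B i.
  by move=> /lt; rewrite /B'; case: eqP => // ->; rewrite ltnn.
have lB' : \prod_(i <- l') lprob (B' i) = (\prod_(i <- l) lprob (B i)) *
    \prod_(x <- s) percolation_rule p q (win (ext (nbh s) c) x) (b x).
  rewrite big_cat big_map; congr (_ * _).
    by apply: eq_big_seq => i /BE ->.
  by apply: eq_bigr => x _; rewrite /B' /= eqxx lprob_step.
have ul' : uniq l'.
  rewrite cat_uniq ul map_inj_uniq ?us ?andbT; last by move=> x y [].
  by apply/hasPn => _ /mapP[x xs ->]; apply/negP => /lt; rewrite ltnn.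
have lt' i : i \in l' -> (i.1 < t.+1)%N.
  by rewrite mem_cat => /orP[/lt/ltnW//|/mapP[x _ ->]].
rewrite mulrCA [RHS]mulrC -lB' -(IH l' B' t.+1 (nbh s))// ?nbh_uniq//; congr Pr.
apply/seteqP; split=> w /=.
  move=> [[HB Hs] /(restrP _ _ (nbh_uniq s)) Hc]; split => // i.
  rewrite mem_cat => /orP[il|/mapP[x xs ->]]; first by rewrite BE// HB.
  by rewrite /B' /= eqxx -Hs//; apply/eqP; congr step; apply/esym/(eq_win xs).
move=> [HB Hc]; split; last exact/(restrP _ _ (nbh_uniq s)).
split=> [i il|x xs].
  by rewrite -BE// HB// mem_cat il.
have := HB (t, x); rewrite mem_cat map_f ?orbT// => /(_ isT).
by rewrite /B' /= eqxx => /eqP <-; congr step; exact: (eq_win xs).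
Qed.

Lemma back_law eta k t (s : seq int) b : uniq s ->
  Pr P [set w | forall x, x \in s -> back (Y w) eta k t x = b x] =
  iter k Phi (delta eta) s b.
Proof.
move=> us; have := @back_law_gen eta k [::] (fun _ _ => true) t s b isT _ us.
rewrite big_nil mul1r => <- //; congr Pr.
by apply/seteqP; split => w /=; [split|case].
Qed.

End Array.
End Transfer.

(** * Weak convergence and uniqueness from cylinder probabilities *)

Section Weak.
Context {R : realType}.

(** The filter generated by agreement with [eta] on finite lists converges to [eta] in each
    coordinate, hence in the product topology. *)
Lemma nbhs_ptws_cyl (eta : {ptws int -> bool}) (U : set {ptws int -> bool}) :
  nbhs eta U -> exists s : seq int, forall xi : int -> bool, {in s, xi =1 eta} -> U xi.
Proof.
pose F : set_system (int -> bool) :=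
  filter_from setT (fun s : seq int => [set xi : int -> bool | {in s, xi =1 eta}]).
have FF : Filter F.
  apply: filter_from_filter; first by exists [::].
  move=> s s' _ _; exists (s ++ s') => // xi /= H.
  by split=> x xs; apply: H; rewrite mem_cat xs ?orbT.
have : {ptws, F --> eta}.
  apply/cvg_sup => x; apply/cvg_image.
    by rewrite eqEsubset; split=> b // _; exists (fun=> b).
  move=> V /= Vx; exists ((fun xi : int -> bool => xi x) @^-1` V).
    by exists [:: x] => // xi /= H; rewrite H ?inE//; exact: nbhs_singleton.
  by rewrite image_preimage// eqEsubset; split=> b // _; exists (fun=> b).
by move=> /[apply] -[s _ sU]; exists s => xi H; exact: sU.
Qed.

Lemma cyl_nbhs (eta : {ptws int -> bool}) (s : seq int) :
  nbhs eta [set xi : {ptws int -> bool} | {in s, xi =1 eta}].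
Proof.
elim: s => [|x s IH]; first exact: filterS filterT.
have px : nbhs eta [set xi : {ptws int -> bool} | xi x = eta x].
  apply: (@proj_continuous int (fun=> bool) x eta [set b | b = eta x]).
  by apply: open_nbhs_nbhs; split => //; exact: discrete_open.
apply: filterS2 px IH => xi /= E H y; rewrite inE => /orP[/eqP->//|]; exact: H.
Qed.

(* Uniform continuity: the space of configurations is compact. *)
Lemma continuous_cyl_approx (f : {ptws int -> bool} -> R) (e : R) :
  continuous f -> 0 < e -> exists2 s : seq int, uniq s &
    forall xi xi' : int -> bool, {in s, xi =1 xi'} -> `|f xi - f xi'| <= e.
Proof.
move=> cf e0.
have H eta : exists s : seq int, forall xi : int -> bool, {in s, xi =1 eta} -> `|f eta - f xi| < e / 2.
  apply: (@nbhs_ptws_cyl eta [set xi | `|f eta - f xi| < e / 2]).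
  by have /cvgrPdist_lt/(_ (e / 2)) := cf eta; apply; rewrite divr_gt0.
have [S SP] := choice H.
have cT : compact [set: {ptws int -> bool}].
  rewrite (_ : [set: _] = [set g : forall i : int, bool | forall i, [set: bool] (g i)]).
    by apply: (@tychonoff int (fun=> bool) (fun=> setT)) => _; exact: bool_compact.
  by apply/seteqP; split.
(* Along this filter, near means for every list containing some fixed finite list; the near-covering
   form of compactness then yields one list valid at all configurations. *)
pose F : set_system (seq int) :=
  filter_from setT (fun s : seq int => [set s' : seq int | {subset s <= s'}]).
have FF : Filter F.
  apply: filter_from_filter; first by exists [::].
  move=> s s' _ _; exists (s ++ s') => // r /= rP.
  by split=> x xs; apply: rP; rewrite mem_cat xs ?orbT.
pose Q (s : seq int) (xi : {ptws int -> bool}) :=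
  forall xi' : int -> bool, {in s, xi =1 xi'} -> `|f xi - f xi'| <= e.
have [eta _|s _ sQ] := (compact_near_coveringP _).1 cT (seq int) F Q FF.
  exists ([set xi : int -> bool | {in S eta, xi =1 eta}],
          [set s' : seq int | {subset S eta <= s'}]) => /=.
    by split; [exact: cyl_nbhs|exists (S eta)].
  move=> [xi s] /= [He sub] xi' E.
  have He' : {in S eta, xi' =1 eta} by move=> x xs; rewrite -He// E//; exact: sub.
  have := SP _ _ He; have := SP _ _ He' => ? ?; rewrite -(subrKA (f eta)).
  by apply: (le_trans (ler_normD _ _)); rewrite (distrC (f xi)); lra.
exists (undup s); first exact: undup_uniq.
by move=> xi xi' E; apply: (sQ s _ xi) => // x xs; apply: E; rewrite mem_undup.
Qed.

Lemma measurable_restr_comp (s : seq int) (g : (size s).-tuple bool -> R) : uniq s ->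
  measurable_fun setT (fun eta : config => g (restr s eta)).
Proof.
move=> us _ Y mY; rewrite setTI.
rewrite (_ : _ @^-1` _ =
  [set eta : config | (fun c => `[< Y (g c) >]) (restr s eta)]); last first.
  by apply/seteqP; split=> eta /= /asboolP.
apply: (@measurable_fiber_comp _ config _ (restr s) (fun c => `[< Y (g c) >])) => c.
by rewrite restr_fiber//; exact: measurable_cyl.
Qed.

(** Continuity refers to the product topology and measurability to the cylinders; they are
    reconciled by writing [f] as a pointwise limit of functions of finitely many coordinates. *)
Lemma measurable_continuous (f : {ptws int -> bool} -> R) :
  continuous f -> measurable_fun setT (f : config -> R).
Proof.
move=> cf.
have H n : exists s : seq int, uniq s /\ forall xi xi' : int -> bool,
    {in s, xi =1 xi'} -> `|f xi - f xi'| <= n.+1%:R^-1.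
  have [|s us sP] := @continuous_cyl_approx f n.+1%:R^-1 cf; first by rewrite invr_gt0.
  by exists s.
have [S SP] := choice H.
apply: (@measurable_realfun.measurable_fun_cvg _ config R setT (fun n eta => f (ext (S n) (restr (S n) eta))) f).
  move=> n; apply: (@measurable_restr_comp (S n) (fun c => f (ext (S n) c))).
  exact: (SP n).1.
move=> eta _; apply/cvgrPdist_le => e e0; near=> n.
have : n.+1%:R^-1 <= e.
  by apply: ltW; near: n; exact: (near_infty_natSinv_lt (PosNum e0)).
apply: le_trans; apply: (SP n).2 => x xs; by rewrite ext_restr.
Unshelve. all: by end_near. Qed.

(** A three-epsilon argument: [f] is uniformly close to a function of the word on some [s], whose
    integral is a finite combination of cylinder probabilities. *)
Lemma weakly_converges_fdd (nu_ : nat -> probability config R) (mu : probability config R) :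
  (forall s b, uniq s -> fdd (nu_ t) s b @[t --> \oo] --> fdd mu s b) ->
  weakly_converges nu_ mu.
Proof.
move=> cfdd f cf [M fM].
have mf := measurable_continuous cf.
have fi (nu : probability config R) : nu.-integrable setT (fun eta => (f eta)%:E).
  apply: measurable_bounded_integrable => //.
    by rewrite (le_lt_trans (probability_le1 _ _))// ltry.
  by exists `|M|; split => // x Mx eta _ /=; rewrite (le_trans (fM eta))// (le_trans (ler_norm _))// ltW.
pose J (nu : probability config R) := fine (\int[nu]_eta (f eta)%:E)%E.
have JE (nu : probability config R) : (\int[nu]_eta (f eta)%:E)%E = (J nu)%:E.
  by rewrite /J fineK//; exact: (integrable_fin_num _ (fi nu)).
pose S s (nu : probability config R) :=
  \sum_(c : (size s).-tuple bool) f (ext s c) * fdd nu s (ext s c).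
have JS s e : uniq s -> (forall xi xi' : int -> bool, {in s, xi =1 xi'} ->
    `|f xi - f xi'| <= e) -> forall nu, `|J nu - S s nu| <= e.
  move=> us sP nu.
  (* The shift [a] will be [- e] and [e], so as to bound the integral of [f] from both sides. *)
  have intS a : (\int[nu]_eta (f (ext s (restr s eta)) + a)%:E)%E = (S s nu + a)%:E.
    rewrite (@integral_finite _ _ _ nu _ (restr s) (fun c => f (ext s c) + a)).
      congr EFin; rewrite /S -[in RHS](mulr1 a) -(sum_fdd nu us) mulr_sumr -big_split.
      by apply: eq_bigr => c _ /=; rewrite restr_fiber// mulrDl.
    by move=> c; rewrite restr_fiber//; exact: measurable_cyl.
  have intb a : nu.-integrable setT (fun eta => (f (ext s (restr s eta)) + a)%:E).
    apply: measurable_bounded_integrable => //.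
    - by rewrite (le_lt_trans (probability_le1 _ _))// ltry.
    - exact: (@measurable_restr_comp s (fun c => f (ext s c) + a)).
    - exists (`|M| + `|a|); split => // x Mx eta _ /=.
      rewrite (le_trans (ler_normD _ _))// (le_trans _ (ltW Mx))// lerD2r.
      by rewrite (le_trans (fM _))// ler_norm.
  have d eta : `|f eta - f (ext s (restr s eta))| <= e.
    by apply: sP => x xs; rewrite ext_restr.
  rewrite ler_distl; apply/andP; split; rewrite -lee_fin -JE -intS.
    apply: le_integral => //; [exact: fi|].
    by move=> eta _; rewrite lee_fin; have := d eta; rewrite ler_distl => /andP[].
  apply: le_integral => //; [exact: fi|].
  by move=> eta _; rewrite lee_fin; have := d eta; rewrite ler_distl => /andP[].
rewrite JE; under eq_fun do rewrite JE.
apply: cvg_EFin; first by near=> n.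
apply/cvgrPdist_le => e e0.
have e3 : 0 < e / 3 by rewrite divr_gt0.
have [s us sP] := continuous_cyl_approx cf e3.
have cS : S s (nu_ t) @[t --> \oo] --> S s mu.
  apply: cvg_big => [|c _]; first exact: add_continuous.
  by apply: cvgMl_tmp; exact: cfdd.
move/cvgrPdist_le : cS => /(_ _ e3) cS.
near=> n.
have : `|S s mu - S s (nu_ n)| <= e / 3 by near: n.
have := JS s _ us sP mu; have := JS s _ us sP (nu_ n).
rewrite !ler_distl => /andP[? ?] /andP[? ?] /andP[? ?]; apply/andP; split => /=; lra.
Unshelve. all: by end_near. Qed.

(** Cylinders, together with the empty set for incompatible ones, are stable under intersection and
    generate the sigma-field. *)
Lemma fdd_unique (mu mu' : probability config R) :
  (forall s b, uniq s -> fdd mu s b = fdd mu' s b) ->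
  forall A : set config, measurable A -> mu A = mu' A.
Proof.
move=> E A mA.
pose G : set (set config) := [set A | A = set0 \/ exists s b, uniq s /\ A = cyl s b].
apply: (measure_unique G (fun _ => setT)) => //.
- have cG : <<s cylinders >> `<=` <<s G >>.
    apply: smallest_sub; first exact: smallest_sigma_algebra.
    move=> _ [x [b ->]]; apply: sub_sigma_algebra; right; exists [:: x], (fun=> b).
    split=> //; apply/seteqP; split=> eta /=; last by apply; rewrite inE.
    by move=> H y; rewrite inE => /eqP->.
  have Gm : <<s G >> `<=` @measurable _ config.
    apply: smallest_sub; first exact: sigma_algebra_measurable.
    by move=> _ [->|[s [b [us ->]]]]; [exact: measurable0|exact: measurable_cyl].
  by apply/seteqP; split; [exact: cG|exact: Gm].
- move=> C D [->|[s [b [us ->]]]]; first by rewrite set0I; left.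
  move=> [->|[s' [b' [us' ->]]]]; first by rewrite setI0; left.
  (* A common point [eta] itself prescribes the symbols of the intersection on [s ++ s']. *)
  have [[eta [/= H H']]|N] := pselect (exists eta, (cyl s b `&` cyl s' b') eta).
    right; exists (undup (s ++ s')), eta; rewrite undup_uniq; split => //.
    apply/seteqP; split => xi /=.
      move=> [K K'] x; rewrite mem_undup mem_cat => /orP[xs|xs].
        by rewrite K// H.
      by rewrite K'// H'.
    by move=> K; split=> x xs; (rewrite -H// || rewrite -H'//); rewrite K// mem_undup mem_cat xs ?orbT.
  by left; apply/seteqP; split => // eta He; apply: N; exists eta.
- by move=> _; right; exists [::], (fun=> true); split=> //; apply/seteqP; split.
- by rewrite bigcup_const//; exists 0%N.
- move=> _ [->|[s [b [us ->]]]]; first by rewrite !measure0.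
  have mc := measurable_cyl s b.
  apply: (etrans (esym (PrE mu mc))); apply: etrans (PrE mu' mc).
  by congr EFin; exact: E.
- by move=> _; rewrite (le_lt_trans (probability_le1 _ _))// ltry.
Qed.
End Weak.

(** * The game as a backward iteration *)

Section Game_array.
Variables (g : version).

(** The offset [m] encodes translation: site [n] of the game becomes site 0 of the array shifted by
    [n], so all sites share the probabilities computed at 0. *)
Definition game_array (y : vertex -> label) (m : int) (t : nat) (n : int) : label :=
  y (coord g t (m + n)).

Lemma all_win (B : int -> bool) n :
  (win B n == [tuple false; false; false]) = [&& ~~ B n, ~~ B (n + 1) & ~~ B (n + 2)].
Proof.
apply/eqP/idP => [/(congr1 val)[-> -> ->]//|/and3P[H0 H1 H2]].
by apply: val_inj; rewrite /= (negbTE H0) (negbTE H1) (negbTE H2).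
Qed.

Lemma back_val_at y m e k t n :
  back (game_array y m) (fun=> e) k t n = val_at g y e k (coord g t (m + n)).
Proof.
elim: k t n => [//|k IH] t n; rewrite /= /step /game_array -/(game_array y m).
case: (y _) => //; rewrite all_win !IH Out_coord /=.
by rewrite !addrA andbT.
Qed.

(** An outcome forced within [k] moves never reads the boundary, so the conclusion of the monotone
    sandwich holds for an arbitrary [eta]. *)
Lemma back_decided y eta k t n :
  (Lwithin g y k (coord g t n) -> back (game_array y 0) eta k t n) /\
  (Wwithin g y k (coord g t n) -> ~~ back (game_array y 0) eta k t n).
Proof.
elim: k t n => [//|k IH] t n; rewrite LwithinS WwithinS /= /step /game_array add0r.
rewrite -/(game_array y 0); case: (y _) => //; rewrite all_win Out_coord /= orbF andbT.
have [L0 W0] := IH t.+1 n; have [L1 W1] := IH t.+1 (n + 1).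
have [L2 W2] := IH t.+1 (n + 2); split.
  by move=> /and3P[/W0-> /W1-> /W2->].
by case/or3P => [/L0|/L1|/L2] ->; rewrite ?andbF.
Qed.

(** Vertices that are never decided share the symbol [false] with those in W. *)
Definition limit_config (y : vertex -> label) (n : int) : bool :=
  `[< exists k, Lwithin g y k (coord g 0 n) >].

Definition undecided (y : vertex -> label) (k : nat) (v : vertex) : bool :=
  ~~ Lwithin g y k v && ~~ Wwithin g y k v.

Lemma back_limit y eta k n : ~ undecided y k (coord g 0 n) ->
  back (game_array y 0) eta k 0 n = limit_config y n.
Proof.
have [HL HW] := back_decided y eta k 0 n.
move/negP; rewrite negb_and !negbK => /orP[L|W].
  by rewrite HL//; apply/esym/asboolP; exists k.
rewrite (negbTE (HW W)); apply/esym/asboolP => -[j L].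
apply: (@LWwithin_disj g y (maxn k j) (coord g 0 n)).
  by apply: Lwithin_mono L; rewrite leq_maxr.
by apply: Wwithin_mono W; rewrite leq_maxl.
Qed.

Lemma undecided_incr y k v : undecided y k.+1 v -> undecided y k v.
Proof.
move=> /andP[L W]; apply/andP; split.
  by apply: contra L => /(within_incr g y k v).1.
by apply: contra W => /(within_incr g y k v).2.
Qed.

End Game_array.

(** * The draw probability as a limit *)

Section Percolation.
Context {R : realType}.
Variables (p q : R) (d : measure_display) (Omega : measurableType d).
Variables (P : probability Omega R) (lab : Omega -> vertex -> label).
Hypothesis hlab : iid_labelling p q P lab.
Variable g : version.

Lemma Pr_label (v : vertex) (B : label -> bool) :
  P [set w | B (lab w v)] = (lprob p q B)%:E.
Proof.
have mV := labelling_measurable hlab v.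
have PV l : Pr P [set w | lab w v = l] = label_prob p q l.
  by rewrite /Pr (labelling_law hlab).
have mB l : measurable [set w | B l && `[< lab w v = l >]].
  case: (B l) => /=; last by rewrite (_ : [set _ | _] = set0)//; apply/seteqP; split.
  by rewrite (_ : [set _ | _] = [set w | lab w v = l])//; apply/seteqP; split=> w /asboolP.
have PB l : Pr P [set w | B l && `[< lab w v = l >]] = if B l then label_prob p q l else 0.
  case: (B l) => /=; last first.
    by rewrite (_ : [set _ | _] = set0) ?/Pr ?measure0//; apply/seteqP; split.
  by rewrite -PV; congr Pr; apply/seteqP; split=> w /asboolP.
have -> : [set w | B (lab w v)] = [set w | B Trap && `[< lab w v = Trap >]] `|`
    [set w | B Target && `[< lab w v = Target >]] `|`
    [set w | B Open && `[< lab w v = Open >]].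
  apply/seteqP; split=> w /=.
    by case E : (lab w v) => Bw; [left; left|left; right|right]; rewrite Bw; apply/asboolP.
  by case=> [[]|] /andP[? /asboolP->].
rewrite -PrE; last by apply: measurableU => //; exact: measurableU.
congr EFin; rewrite !PrU//; first by rewrite !PB.
- by apply/seteqP; split=> w //= -[/andP[_ /asboolP->] /andP[_ /asboolP]].
- exact: measurableU.
- by apply/seteqP; split=> w //= -[[]/andP[_ /asboolP->] /andP[_ /asboolP]].
Qed.

Lemma game_array_iid m : iid_array p q P (fun w => game_array g (lab w) m).
Proof.
split=> [t n l|l B ul]; first exact: (labelling_measurable hlab).
pose v (i : nat * int) := coord g i.1 (m + i.2).
have vI : injective v.
  by move=> [t n] [t' n'] /coord_inj [/= -> /addrI ->].
(* Constraints move from indices to vertices; quantifying over all [i] above [u] avoids an inverse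
   of [v], and [vI] recovers [B i] at [v i]. *)
pose B' (u : vertex) : set label := [set lb | forall i, v i = u -> B i lb].
have B'E i w : B' (v i) (lab w (v i)) = B i (lab w (v i)) :> Prop.
  by rewrite propeqE; split=> [|Bi j /vI ->//]; apply.
have -> : [set w | forall i, i \in l -> B i (game_array g (lab w) m i.1 i.2)] =
    \bigcap_(u in [set` map v l]) [set w | B' u (lab w u)].
  apply/seteqP; split=> w /=.
    by move=> H _ /mapP[i il ->] /=; rewrite B'E; exact: H.
  by move=> H i il; rewrite /game_array -/(v i) -B'E; apply: (H (v i)) => /=; exact: map_f.
rewrite /Pr (labelling_independent hlab) ?map_inj_uniq// big_map.
under eq_bigr => i _.
  have -> : [set w | B' (v i) (lab w (v i))] = [set w | B i (lab w (v i))].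
    by apply/seteqP; split=> w /=; rewrite B'E.
  rewrite Pr_label; over.
by rewrite prodEFin.
Qed.

(* The probability of the symbol 1 at the origin under F^k(delta_e). *)
Definition pure_fdd (e : bool) (k : nat) : R :=
  iter k (Phi p q) (delta (fun=> e)) [:: 0] (fun=> true).

Lemma measurable_val_at e k n : measurable [set w | val_at g (lab w) e k (coord g 0 n)].
Proof.
rewrite (_ : [set w | _] =
  [set w | back (game_array g (lab w) n) (fun=> e) k 0 0 = true]).
  exact: (measurable_back (game_array_iid n)).
by apply/seteqP; split=> w /=; rewrite back_val_at addr0.
Qed.

Lemma Pr_val_at e k n : Pr P [set w | val_at g (lab w) e k (coord g 0 n)] = pure_fdd e k.
Proof.
rewrite /pure_fdd -(back_law (game_array_iid n) _ _ 0%N)//; congr Pr.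
apply/seteqP; split=> w /= H.
  by move=> x; rewrite inE => /eqP->; rewrite back_val_at addr0 H.
by have := H 0; rewrite inE back_val_at addr0 => ->.
Qed.

Lemma measurable_undecided k n : measurable [set w | undecided g (lab w) k (coord g 0 n)].
Proof.
rewrite (_ : [set w | _] = [set w | val_at g (lab w) (~~ odd k) k (coord g 0 n)] `\`
  [set w | val_at g (lab w) (odd k) k (coord g 0 n)]).
  by apply: measurableD; exact: measurable_val_at.
apply/seteqP; split=> w /=; rewrite /undecided /Wwithin negbK.
  by move=> /andP[/negP].
by move=> [-> /negP ->].
Qed.

(** L within [k] implies not W within [k]; the undecided event is the difference of these two nested
    events, each the value 1 of a constant-boundary iteration. *)
Lemma Pr_undecided k n : Pr P [set w | undecided g (lab w) k (coord g 0 n)] =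
  pure_fdd (~~ odd k) k - pure_fdd (odd k) k.
Proof.
apply/eqP; rewrite eq_sym subr_eq -(Pr_val_at (odd k) k n) -(Pr_val_at (~~ odd k) k n).
rewrite -PrU; [|exact: measurable_undecided|exact: measurable_val_at|]; last first.
  by apply/seteqP; split=> w //= -[/andP[/negP]].
apply/eqP; congr Pr; apply/seteqP; split=> w /=.
  rewrite /undecided /Wwithin negbK => H.
  by case E : (Lwithin g (lab w) k (coord g 0 n)); [right|left; rewrite H].
case=> [/andP[_]|L]; first by rewrite negbK.
apply/negPn/negP => W; exact: (@LWwithin_disj g (lab w) k (coord g 0 n)).
Qed.

(** By [classDE] a draw is the decreasing intersection of the undecided events, so continuity from
    above applies. *)
Lemma draw0P : draw_probability P lab g = 0%E <->
  pure_fdd (~~ odd k) k - pure_fdd (odd k) k @[k --> \oo] --> (0 : R).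
Proof.
pose U k := [set w | undecided g (lab w) k (coord g 0 0)].
have mU k : measurable (U k) by exact: measurable_undecided.
have DE : [set w | classD g (lab w) (0, 0)] = \bigcap_k U k.
  apply/seteqP; split=> w /=; rewrite classDE /U /undecided coord0.
    by move=> H k _ /=.
  by move=> H k; apply: H.
have mD : measurable (\bigcap_k U k) by exact: bigcapT_measurable.
have cU : (P \o U) @ \oo --> P (\bigcap_k U k).
  apply: nonincreasing_cvg_mu => //.
    by rewrite (le_lt_trans (probability_le1 _ _))// ltry.
  apply/nonincreasing_seqP => k; apply/subsetPset => w; exact: undecided_incr.
have UE : P \o U = EFin \o (fun k => pure_fdd (~~ odd k) k - pure_fdd (odd k) k).
  by apply/funext => k /=; rewrite -PrE// Pr_undecided.
rewrite /draw_probability DE; rewrite UE in cU; split=> [D0|u0].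
  rewrite D0 in cU.
  have /fine_cvgP[_ H] := cU; exact: H.
by apply: (cvg_unique _ cU) => //; apply/fine_cvgP; split; [exact: nearW|exact: u0].
Qed.

End Percolation.

(** * Ergodicity and the vanishing of the undecided probability *)

Section Decided.
Context {R : realType}.
Variables (p q : R) (d : measure_display) (Omega : measurableType d).
Variables (P : probability Omega R) (lab : Omega -> vertex -> label).
Hypothesis hlab : iid_labelling p q P lab.
Variable g : version.

Let F := percolation_pca p q.
Let u k : R := pure_fdd p q (~~ odd k) k - pure_fdd p q (odd k) k.

(** The orbits of the two constant configurations have the same weak limit; it is tested on the
    symbol at 0, a continuous function since [bool] is discrete. *)
Lemma ergodic_merge : ergodic F -> u @ \oo --> (0 : R).
Proof.
move=> [mu [_ _ conv]].
(* The iterates exist as probability measures because the labels realise them, as laws of [back]. *)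
have lawE e k : exists nu : probability config R, forall s b, uniq s ->
    fdd nu s b = iter k (Phi p q) (delta (fun=> e)) s b.
  have iidY := game_array_iid hlab g 0.
  have [nu nuE] := law_exists P (measurable_back iidY (fun=> e) k 0%N).
  exists nu => s b us; rewrite -(back_law iidY _ _ 0%N)//.
  by rewrite /fdd /Pr nuE//; exact: measurable_cyl.
have orbE e : exists nu_ : nat -> probability config R, is_orbit F nu_ /\
    forall k s b, uniq s -> fdd (nu_ k) s b = iter k (Phi p q) (delta (fun=> e)) s b.
  have [nu_ nuE] := choice (lawE e); exists nu_; split => // k.
  apply/is_imageP => s b us; rewrite nuE// iterS !PhiE.
  by apply: eq_bigr => c _; rewrite nuE ?nbh_uniq.
pose f (xi : {ptws int -> bool}) : R := (xi 0)%:R.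
have cf : continuous f.
  move=> xi; apply: (@continuous_comp _ bool R (fun xi : {ptws int -> bool} => xi 0)
    (fun b : bool => b%:R : R)).
    exact: (@proj_continuous int (fun=> bool) 0).
  move=> V /= nV; apply: open_nbhs_nbhs; split; first exact: discrete_open.
  exact: (nbhs_singleton nV).
have fE (nu : probability config R) :
    (\int[nu]_eta (f eta)%:E)%E = (fdd nu [:: 0] (fun=> true))%:E.
  rewrite (@integral_finite _ _ _ nu _ (fun eta : config => eta 0)
    (fun b : bool => b%:R : R)); last exact: measurable_coord.
  rewrite big_bool /= mul1r mul0r addr0; congr EFin; congr Pr.
  apply/seteqP; split=> eta /= H; last by rewrite H ?inE.
  by move=> x; rewrite inE => /eqP->.
have cvgp e : pure_fdd p q e @ \oo --> fdd mu [:: 0] (fun=> true).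
  have [nu_ [orb nuE]] := orbE e.
  have fb : exists M : R, forall eta, `|f eta| <= M.
    by exists 1 => eta; rewrite /f; case: (eta 0); rewrite ?normr1 ?normr0.
  have := conv nu_ orb f cf fb; rewrite fE.
  have -> : (fun k => (\int[nu_ k]_eta (f eta)%:E)%E) = EFin \o pure_fdd p q e.
    by apply/funext => k; rewrite fE nuE.
  by move=> /fine_cvgP[_ H]; exact: H.
(* The parity of [k] only swaps the two terms of [u k], so the absolute values coincide. *)
have : (fun k => `|pure_fdd p q true k - pure_fdd p q false k|) @ \oo --> (0 : R).
  rewrite -(@normr0 R R) -(subrr (fdd mu [:: 0] (fun=> true))).
  by apply: cvg_norm; apply: cvgB; exact: cvgp.
move=> H; apply: norm_cvg0; apply: cvg_trans H.
apply: near_eq_cvg; apply: nearW => k; rewrite /= /u.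
by case: (odd k) => //=; rewrite distrC.
Qed.

Definition limit_law_spec (mu : probability config R) :=
  forall A : set config, measurable A ->
    mu A = P [set w | A (limit_config g (lab w))].

Lemma measurable_limit x b : measurable [set w | limit_config g (lab w) x = b].
Proof.
have mT : measurable [set w | limit_config g (lab w) x].
  rewrite (_ : [set w | _] =
    \bigcup_k [set w | Lwithin g (lab w) k (coord g 0 x)]).
    by apply: bigcupT_measurable => k; exact: (measurable_val_at hlab).
  apply/seteqP; split=> w /=; first by move=> /asboolP[k Lk]; exists k.
  by move=> [k _ Lk]; apply/asboolP; exists k.
case: b => //.
rewrite (_ : [set w | _] = ~` [set w | limit_config g (lab w) x]).
  exact: measurableC.
by apply/seteqP; split=> w /=; case: (limit_config _ _ _).
Qed.

Lemma limit_law_exists : exists mu, limit_law_spec mu.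
Proof. exact: (law_exists P measurable_limit). Qed.

Variable mu : probability config R.
Hypothesis muP : limit_law_spec mu.

(** A coupling through the same labels: [back] and the limit configuration agree at each decided
    site, and a union bound over [s] controls the undecided ones. *)
Lemma back_limit_dist eta k s b : uniq s ->
  `|iter k (Phi p q) (delta eta) s b - fdd mu s b| <= (size s)%:R * u k.
Proof.
move=> us; have iidY := game_array_iid hlab g 0.
pose U := [set w | exists2 x, x \in s & undecided g (lab w) k (coord g 0 x)].
have UP : measurable U /\ Pr P U <= (size s)%:R * u k.
  rewrite /U; elim: (s) => [|x r [mU IH]].
    rewrite (_ : [set w | _] = set0); first by rewrite /Pr measure0 mul0r.
    by apply/seteqP; split=> w //= -[].
  set V := [set w | exists2 x, x \in r & undecided g (lab w) k (coord g 0 x)] in mU IH.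
  set W := [set w | undecided g (lab w) k (coord g 0 x)].
  have mW : measurable W := measurable_undecided hlab g k x.
  have -> : [set w | exists2 y, y \in x :: r & undecided g (lab w) k (coord g 0 y)] =
      (W `|` (V `\` W)).
    apply/seteqP; split=> w /=.
      move=> [y]; rewrite inE => /orP[/eqP->|yr] Uy; first by left.
      by have [?|?] := pselect (W w); [left|right; split=> //; exists y].
    case=> [Ww|[[y yr Uy] _]]; first by exists x => //; rewrite mem_head.
    by exists y => //; rewrite inE yr orbT.
  split; first by apply: measurableU => //; exact: measurableD.
  rewrite PrU//; [|exact: measurableD|].
    rewrite (Pr_undecided hlab) -/(u k) /= -natr1 mulrDl mul1r addrC lerD2r.
    by apply: le_trans IH; apply: (Pr_le P (measurableD mU mW) mU) => w [].
  by apply/seteqP; split=> w //= -[? []].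
rewrite -(back_law iidY _ _ 0%N)// /fdd.
have -> : Pr mu (cyl s b) = Pr P [set w | cyl s b (limit_config g (lab w))].
  by rewrite /Pr muP//; exact: measurable_cyl.
apply: le_trans UP.2; apply: Pr_dist_le UP.1 _; last 1 first.
- move=> w nU; rewrite propeqE; split=> H x xs; have := H x xs;
    rewrite back_limit// => Ux; by apply: nU; exists x.
- exact: measurable_back_cyl iidY _ _ _ _ _.
- by apply: measurable_forall_in => x _; exact: measurable_limit.
Qed.

Lemma merge_cvg (C : R) (a : nat -> R) (l : R) : u @ \oo --> (0 : R) ->
  (forall k, `|a k - l| <= C * u k) -> a @ \oo --> l.
Proof.
move=> u0 aul; apply/subr_cvg0; apply: norm_cvg0.
apply: (@squeeze_cvgr _ _ _ _ (fun=> 0) (fun k => C * u k)); first 2 last.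
- by rewrite -(mulr0 C); apply: cvgMl_tmp.
- by apply: nearW => k; rewrite normr_ge0 aul.
- exact: cvg_cst.
Qed.

(** The bound for point masses is uniform in [eta], so it survives averaging over the initial law,
    whose weights sum to 1. *)
Lemma orbit_dist (nu_ : nat -> probability config R) k s b : uniq s ->
  is_orbit F nu_ -> `|fdd (nu_ k) s b - fdd mu s b| <= (size s)%:R * u k.
Proof.
move=> us orb; pose r := iter k nbh s.
have ur : uniq r by rewrite /r; case: (k) => [//|j]; exact: nbh_uniq.
rewrite (orbit_fdd k b us orb) iter_Phi_sum//; last first.
  by move=> *; exact: fdd_local.
have avg (z : R) : z = \sum_(c : (size r).-tuple bool) z * fdd (nu_ 0%N) r (ext r c).
  by rewrite -mulr_sumr sum_fdd// mulr1.
rewrite (avg (fdd mu s b)) (avg ((size s)%:R * u k)) -sumrB.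
apply: (le_trans (ler_norm_sum _ _ _)).
apply: ler_sum => c _; rewrite -mulrBl normrM (ger0_norm (Pr_ge0 _ _)).
by apply: ler_wpM2r; [exact: Pr_ge0|exact: back_limit_dist].
Qed.

Lemma merge_ergodic : u @ \oo --> (0 : R) -> ergodic F.
Proof.
move=> u0; exists mu.
have orb_cvg nu_ : is_orbit F nu_ -> forall s b, uniq s ->
    fdd (nu_ t) s b @[t --> \oo] --> fdd mu s b.
  by move=> orb s b us; apply: (merge_cvg u0) => k; exact: orbit_dist.
split.
- apply/is_imageP => s b us.
  (* Stationarity follows by letting [k] grow on both sides of [f k.+1 = Phi (f k)], as [Phi] is a
     finite sum. *)
  pose f k := iter k (Phi p q) (delta (fun=> true) : _ -> _ -> R).
  have cf r c : uniq r -> f k r c @[k --> \oo] --> fdd mu r c.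
    by move=> ur; apply: (merge_cvg u0) => k; exact: back_limit_dist.
  have c1 : f k.+1 s b @[k --> \oo] --> fdd mu s b.
    by have := cf s b us; rewrite -cvg_shiftS.
  have c2 : f k.+1 s b @[k --> \oo] --> Phi p q (fdd mu) s b.
    rewrite PhiE; apply: cvg_big => [|c _]; first exact: add_continuous.
    by apply: cvgMr_tmp; apply: cf; exact: nbh_uniq.
  exact: (cvg_unique _ c1 c2).
- move=> mu' st A mA; apply: fdd_unique => // s b us.
  (* A stationary law is a constant orbit, so convergence to [mu] forces equality. *)
  have := orb_cvg (fun=> mu') (fun=> st) s b us.
  by move=> H; apply: (cvg_unique _ _ H) => //; exact: cvg_cst.
- by move=> nu_ orb; apply: weakly_converges_fdd => s b; exact: orb_cvg.
Qed.

End Decided.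

Theorem proposition2p2 (R : realType) (p q : R)
  (hp : 0 <= p <= 1) (hq : 0 <= q <= 1) (hpq : 0 < p + q <= 1)
  (d : measure_display) (Omega : measurableType d) (P : probability Omega R)
  (lab : Omega -> vertex -> label) (hlab : iid_labelling p q P lab)
  (g : version) :
  draw_probability P lab g = 0%E <-> ergodic (percolation_pca p q).
Proof.
rewrite (draw0P hlab); split; last exact: (ergodic_merge hlab g).
have [mu muP] := limit_law_exists hlab g.
exact: (merge_ergodic hlab muP).
Qed.
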